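(* Let $f:\mathbb{T}^2\to\mathbb{T}^2$ be a non-resonant torus homeomorphism and let $\Lambda_1\subset\mathbb{T}^2$ be a nonempty compact connected set such that $f(\Lambda_1)\subset\Lambda_1$. Then for every connected neighborhood $U$ of $\Lambda_1$ there exists $K>0$ such that the following holds: if $\Lambda_2\subset\mathbb{T}^2$ is a compact set such that $p^{-1}(\Lambda_2)\subset\mathbb{R}^2$ has a connected component of diameter larger than $K$, then $U\cap\Lambda_2\neq\emptyset$.
   Context: $\mathbb{T}^2=\mathbb{R}^2/\mathbb{Z}^2$ and $p:\mathbb{R}^2\to\mathbb{T}^2$ is the canonical projection (universal cover). $\mathrm{Homeo}_0(\mathbb{T}^2)$ is the set of homeomorphisms of $\mathbb{T}^2$ homotopic to the identity. The rotation set of a lift $F:\mathbb{R}^2\to\mathbb{R}^2$ of $f\in\mathrm{Homeo}_0(\mathbb{T}^2)$ is the set of all limits of sequences $\frac{F^{n_i}(z_i)-z_i}{n_i}$ with $z_i\in\mathbb{R}^2$, $n_i\to+\infty$; changing the lift translates it by an integer vector. $f\in\mathrm{Homeo}_0(\mathbb{T}^2)$ is called non-resonant if its rotation set is a single vector $(\alpha,\beta)$ (defined modulo $\mathbb{Z}^2$) such that $1,\alpha,\beta$ are rationally independent (linearly independent over $\mathbb{Q}$). Equivalently, for every lift $F$ and every $z\in\mathbb{R}^2$, $\lim_{n\to\infty}\frac{F^n(z)-z}{n}=(\alpha,\beta)\ (\mathrm{mod}\ \mathbb{Z}^2)$ with $1,\alpha,\beta$ rationally independent. *)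

(* Defs.v *)
From HB Require Import structures.
From mathcomp Require Import all_boot all_order all_algebra generic_quotient.
From mathcomp Require Import all_classical all_reals all_analysis.

Set Implicit Arguments.
Unset Strict Implicit.
Unset Printing Implicit Defensive.
Import Order.TTheory GRing.Theory Num.Theory.
Import numFieldNormedType.Exports.

Local Open Scope classical_set_scope.
Local Open Scope quotient_scope.
Local Open Scope ring_scope.

(* The regular modules R^o only serve to make R^2 a normed R-module; the
   topology is the product topology. *)
Notation plane R := (R^o * R^o)%type.

Definition Z2_rel (R : realType) (z w : plane R) : bool :=
  (z.1 - w.1 \is a Num.int) && (z.2 - w.2 \is a Num.int).

Lemma Z2_relxx (R : realType) : reflexive (@Z2_rel R).
Proof. by move=> z; rewrite /Z2_rel !subrr rpred0. Qed.

Lemma Z2_rel_sym (R : realType) : symmetric (@Z2_rel R).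
Proof.
by move=> z w; rewrite /Z2_rel -(opprB w.1) -(opprB w.2) !rpredN.
Qed.

Lemma Z2_rel_trans (R : realType) : transitive (@Z2_rel R).
Proof.
move=> w z t /andP[zw1 zw2] /andP[wt1 wt2]; apply/andP.
by split; [rewrite -(subrKA w.1)|rewrite -(subrKA w.2)]; exact: rpredD.
Qed.

Definition Z2_equiv (R : realType) :=
  EquivRel (@Z2_rel R) (@Z2_relxx R) (@Z2_rel_sym R) (@Z2_rel_trans R).

Definition torus (R : realType) := {eq_quot Z2_equiv R}.

HB.instance Definition _ (R : realType) :=
  Topological.copy (torus R) (quotient_topology (torus R)).
HB.instance Definition _ (R : realType) := Quotient.on (torus R).

Definition torus_proj (R : realType) (z : plane R) : torus R := \pi_(torus R) z.

Definition homeomorphism (T U : topologicalType) (f : T -> U) : Prop :=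
  continuous f /\
  exists g : U -> T, [/\ cancel f g, cancel g f & continuous g].

Definition homotopic (R : realType) (T U : topologicalType) (f g : T -> U) :
    Prop :=
  exists H : R * T -> U,
    [/\ {within `[0, 1]%classic `*` [set: T], continuous H},
        forall x, H (0, x) = f x & forall x, H (1, x) = g x].

Definition Homeo0 (R : realType) : set (torus R -> torus R) :=
  [set f : torus R -> torus R | homeomorphism f /\ homotopic R f id].

Definition is_lift (R : realType) (f : torus R -> torus R)
    (F : plane R -> plane R) : Prop :=
  continuous F /\ forall z, torus_proj (F z) = f (torus_proj z).

Definition rotation_set (R : realType) (F : plane R -> plane R) :
    set (plane R) :=
  [set v | exists (z : nat -> plane R) (n : nat -> nat),
    n @ \oo --> \oo /\
    (fun i => (n i)%:R^-1 *: (iter (n i) F (z i) - z i)) @ \oo --> v].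

Definition rationally_independent1 (R : realType) (v : plane R) : Prop :=
  forall a b c : rat,
    ratr a + ratr b * v.1 + ratr c * v.2 = 0 -> [/\ a = 0, b = 0 & c = 0].

(* The rotation sets of two lifts differ by an integer translation, which
   preserves both requirements on v, so it does not matter which lift is used. *)
Definition non_resonant (R : realType) (f : torus R -> torus R) : Prop :=
  Homeo0 f /\
  exists (F : plane R -> plane R) (v : plane R),
    [/\ is_lift f F, rotation_set F = [set v] & rationally_independent1 v].

(* The norm carried by the product type is the sup norm. *)
Definition euclidean_dist (R : realType) (z w : plane R) : R :=
  Num.sqrt ((z.1 - w.1) ^+ 2 + (z.2 - w.2) ^+ 2).

(* -oo on the empty set, +oo on unbounded sets. *)
Definition diameter (R : realType) (A : set (plane R)) : \bar R :=
  ereal_sup [set (euclidean_dist z.1 z.2)%:E | z in A `*` A].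

(* Main.v *)
From Stdlib Require Import Relation_Operators Operators_Properties.
Require Import Defs.
From mathcomp Require Import all_boot all_order all_algebra generic_quotient.
From mathcomp Require Import all_classical all_reals all_analysis.
From mathcomp Require Import ring lra.
Import Order.TTheory GRing.Theory Num.Theory.
Import numFieldNormedType.Exports.
Local Open Scope classical_set_scope.
Local Open Scope ring_scope.

(** Let S be the preimage of L1 in the plane. By compactness, some
e-neighbourhood of S projects into U, so it suffices to bound the connected
sets C that stay at distance at least e from S. The curves of U that one would like to use as
barriers are replaced by finite chains of points of S with steps below e / 8.

A lattice vector g such that such a chain joins z0 to z0 + g is called a period.
If two periods g and h are linearly independent, then C is bounded: repeating
the chain from z0 to z0 + h, and its lattice translates, gives barriers parallel
to h which C cannot cross, so that C has bounded width in the direction normal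
to h, and likewise for g ([chain_barrier], [det_basis_bound]). That chains which
cross must come close to each other is a discrete form of the Poincare-Miranda
theorem, obtained by a telescoping count of crossings ([crossing_chains]).

There are two independent periods because otherwise a nonzero integer vector a
kills all of them ([annihilator_trivial]). Since S is chain connected modulo the
lattice, the linear form dot a then has a well defined integer shadow on S: the
value of dot a on any g such that z is chained to z0 + g. The shadow stays at
bounded distance from dot a, and the lift F increases it by a constant integer
c, so dot a v = c for the rotation vector v, against rational independence.

That argument uses F (z + g) = F z + g for lattice vectors g. Instead of lifting
the homotopy from f to the identity, this is read off from the rotation set: a
rotation set with a single point forces the convergence of (F^n z - z) / n to be
uniform in z ([uniform_rotation]), whereas a nontrivial action of F on the
lattice would make F^n z - z unbounded for arbitrarily large n
([lift_translation]). *)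

(** * Uniform convergence to the rotation vector *)

Section Plane.
Variable R : realType.
Implicit Types (z w : plane R) (F : plane R -> plane R).

Lemma plane_norm_le z (e : R) : (`|z| <= e) = (`|z.1| <= e) && (`|z.2| <= e).
Proof. by rewrite prod_normE ge_max. Qed.

Lemma plane_ivt (g : plane R -> R) z w (c : R) :
  continuous g -> g z <= c <= g w -> exists y, g y = c.
Proof.
move=> gc /andP[zc cw].
pose h (t : R) : R := g (z + t *: (w - z)).
have hc : continuous h.
  move=> t; apply: (@continuous_comp _ _ _ (fun t : R => z + t *: (w - z)) g);
    last exact: gc.
  by apply: cvgD; [exact: cvg_cst|apply: cvgZr_tmp; exact: cvg_id].
have h0 : h 0 = g z by rewrite /h scale0r addr0.
have h1 : h 1 = g w by rewrite /h scale1r addrC subrK.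
have [t _ <-] : exists2 t, t \in `[0, 1]%R & h t = c.
  apply: IVT => //; first exact: continuous_subspaceT.
  by rewrite h0 h1 ge_min zc le_max cw orbT.
by eexists.
Qed.

Lemma plane_annulus_compact (v : plane R) (r s : R) :
  compact [set w : plane R | r <= `|w - v| <= s].
Proof.
have -> : [set w : plane R | r <= `|w - v| <= s] =
  (`[v.1 - s, v.1 + s]%classic `*` `[v.2 - s, v.2 + s]%classic) `&`
  [set w : plane R | r <= `|w - v|].
  apply/seteqP; split=> w /=; rewrite !in_itv/= plane_norm_le -!ler_distl.
    by case/and3P.
  by case=> [] [-> ->] ->.
apply: compact_closedI.
  by apply: compact_setX; exact: segment_compact.
apply: (@closed_comp _ _ (fun w : plane R => `|w - v|) [set x | r <= x]);
  last exact: closed_ge.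
move=> w _; apply: cvg_norm; apply: cvgB; [exact: cvg_id|exact: cvg_cst].
Qed.

(** Stated with a product filter, so that near-covering turns it into a uniform
statement over a compact set of vectors l. *)
Lemma rotation_set_avoid F (l : plane R) : ~ rotation_set F l ->
  \forall l' \near l & n \near \oo,
    forall z, n%:R^-1 *: (iter n F z - z) <> l'.
Proof.
move=> rotl; apply: contrapT => navoid; apply: rotl.
have bad k : exists zn : plane R * nat, (k <= zn.2)%N /\
    `|l - zn.2%:R^-1 *: (iter zn.2 F zn.1 - zn.1)| < k.+1%:R^-1.
  apply: contrapT => nobad; apply: navoid.
  exists (ball l k.+1%:R^-1, [set n | (k <= n)%N]); first split => /=.
  - by apply: nbhsx_ballx.
  - exact: nbhs_infty_ge.
  move=> [l' n] [/= + kn] z zl'; rewrite -ball_normE /ball_/= -zl' => zn.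
  by apply: nobad; exists (z, n).
have [zn znP] := choice bad.
exists (fst \o zn), (snd \o zn); split.
  apply/cvgnyPge => A; exists A => // n /= An.
  by apply: leq_trans An _; case: (znP n).
apply/cvgrPdist_lt => e e0.
near=> k; case: (znP k) => _ /lt_trans; apply.
near: k; exact: near_infty_natSinv_lt (PosNum e0).
Unshelve. all: by end_near. Qed.

Lemma iter_continuous F n : continuous F -> continuous (iter n F).
Proof.
move=> Fc; elim: n => [|n IH] z; first exact: cvg_id.
by apply: continuous_comp; [exact: IH|exact: Fc].
Qed.

(** For large n no displacement average phi n z lies in the compact annulus
r <= |w - v| <= s. Since phi n is continuous on a connected plane, its values
are then either all inside or all outside of the annulus. They are inside for
the infinitely many n that witness v in the rotation set, and this propagates
from n to n.+1: as F^n.+1 0 = F^n (F 0), the error F^n.+1 0 - n.+1 v exceeds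
F^n (F 0) - F 0 - n v by F 0 - v only, for which the outer radius s leaves
room. *)
Lemma uniform_rotation F (v : plane R) (r : R) :
  continuous F -> rotation_set F = [set v] -> 0 < r ->
  exists N, forall n, (N <= n)%N -> forall z,
    `|iter n F z - z - n%:R *: v| <= n%:R * r.
Proof.
move=> Fc rotF r0.
pose phi n z : plane R := n%:R^-1 *: (iter n F z - z).
have phic n : continuous (fun z => `|phi n z - v|).
  move=> z; apply: cvg_norm; apply: cvgB; last exact: cvg_cst.
  apply: cvgZl_tmp; apply: cvgB; last exact: cvg_id.
  exact: iter_continuous.
pose s := r + `|F 0 - v|.
have rs : r <= s by rewrite /s lerDl.
have [N0 _ avoid] : \forall n \near \oo,
    [set w | r <= `|w - v| <= s] `<=` (fun w => forall z, phi n z <> w).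
  have /compact_near_coveringP := plane_annulus_compact v r s.
  apply => w /= /andP[rw _]; apply: rotation_set_avoid; rewrite rotF => wv.
  by move: rw; rewrite wv subrr normr0 leNgt r0.
have trap n : (N0 <= n)%N -> (exists z, `|phi n z - v| <= s) ->
    forall w, `|phi n w - v| < r.
  move=> Nn [z zs] w; rewrite ltNge; apply/negP => rw.
  have zr : `|phi n z - v| < r.
    rewrite ltNge; apply/negP => rz; apply: (avoid n Nn (phi n z)) => //=.
    by rewrite rz.
  have [|y yr] := plane_ivt _ z w r (phic n); first by rewrite rw ltW.
  by apply: (avoid n Nn (phi n y) _ y) => //=; rewrite yr lexx.
have [n1 Nn1 [z1 z1r]] : exists2 n, (maxn N0 1 <= n)%N &
    exists z, `|phi n z - v| <= s.
  have : rotation_set F v by rewrite rotF.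
  move=> [z [m [mo /cvgrPdist_lt /(_ r r0) zv]]].
  have mN := (cvgnyPge _).1 mo (maxn N0 1).
  near \oo => i; exists (m i); first by near: i; exact: mN.
  exists (z i); apply: ltW; apply: lt_le_trans rs; rewrite distrC.
  by near: i; exact: zv.
have all_n n : (n1 <= n)%N -> forall z, `|phi n z - v| < r.
  move=> /subnK <-; elim: (n - n1)%N => [|k IH].
    rewrite add0n; apply: trap; last by exists z1.
    by apply: leq_trans Nn1; rewrite leq_maxl.
  rewrite addSn; set m := (k + n1)%N in IH *.
  have mN : (maxn N0 1 <= m)%N by rewrite (leq_trans Nn1)// leq_addl.
  apply: trap; first by rewrite leqW// (leq_trans _ mN)// leq_maxl.
  have m0 : 0 < m%:R :> R.
    by rewrite ltr0n (leq_trans _ mN)// leq_maxr.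
  have m10 : 0 < m.+1%:R :> R by rewrite ltr0n.
  exists 0; rewrite /phi subr0 iterSr.
  have -> : m.+1%:R^-1 *: iter m F (F 0) - v =
     m.+1%:R^-1 *: (m%:R *: (phi m (F 0) - v) + (F 0 - v)).
    rewrite /phi scalerBr scalerA mulfV ?gt_eqF// scale1r.
    rewrite -[X in _ - X](scalerK (lt0r_neq0 m10)) -scalerBr; congr (_ *: _).
    by rewrite -natr1 scalerDl scale1r opprD addrA [X in _ = X + _]addrAC subrKA.
  rewrite normrZ gtr0_norm ?invr_gt0// ler_pdivrMl//.
  apply: le_trans (ler_normD _ _) _; rewrite normrZ gtr0_norm//.
  rewrite /s mulrDr; apply: lerD.
    apply: ler_pM => //.
      by rewrite ler_nat.
    exact/ltW/IH.
  by rewrite ler_peMl// ler1n.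
exists n1 => n n1n z.
have n0 : 0 < n%:R :> R.
  by rewrite ltr0n (leq_trans _ n1n)// (leq_trans _ Nn1)// leq_maxr.
have -> : iter n F z - z - n%:R *: v = n%:R *: (phi n z - v).
  by rewrite /phi scalerBr scalerA mulfV ?gt_eqF// scale1r.
by rewrite normrZ gtr0_norm// ler_pM2l// ltW// all_n.
Unshelve. all: by end_near. Qed.

End Plane.

(** * Chains in connected sets *)

(** The points that are chained to x form a relatively clopen subset of A. *)
Lemma connected_linked (T : topologicalType) (A : set T) (r : T -> T -> Prop) :
  (forall x y, r x y -> r y x) ->
  (forall x, A x -> \forall y \near x, r x y) -> connected A ->
  forall x y, A x -> A y ->
    clos_refl_trans T (fun x y => [/\ A x, A y & r x y]) x y.
Proof.
move=> rsym rnear Aco x y Ax Ay.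
pose B := [set y | A y /\
  clos_refl_trans T (fun x y => [/\ A x, A y & r x y]) x y].
have near_open (D : set T) : D `<=` A ->
    open (\bigcup_(z in D) (interior [set w | r z w])) /\
    D `<=` \bigcup_(z in D) (interior [set w | r z w]).
  move=> DA; split; first by apply: bigcup_open => z _; exact: open_interior.
  by move=> z Dz; exists z => //; apply: rnear; exact: DA.
have BE : B = A.
  apply: Aco; first by exists x; split=> //; exact: rt_refl.
    have [oO DO] := near_open B (fun _ => @proj1 _ _).
    eexists; first exact: oO.
    apply/seteqP; split=> [z Bz|z [Az [w [Aw xw] /interior_subset/= wz]]].
      by split; [case: Bz|exact: DO].
    split=> //; apply: rt_trans xw _; exact: rt_step.
  have [oO DO] := near_open (A `\` B) (fun _ => @proj1 _ _).
  eexists; first exact: (open_closedC oO).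
  apply/seteqP; split=> [z [Az xz]|z [Az zO]].
    split=> // -[w [Aw Bw] /interior_subset/= wz]; apply: Bw; split=> //.
    by apply: rt_trans xz _; apply: rt_step; split=> //; exact: rsym.
  by apply: contrapT => Bz; apply: zO; apply: DO.
by have [] : B y by rewrite BE.
Qed.

(** * The torus and lifts of its homeomorphisms *)

Section Torus.
Variable R : realType.
Implicit Types (z w g h : plane R) (x y : torus R).

Definition lattice z := (z.1 \is a Num.int) && (z.2 \is a Num.int).

Lemma lattice0 : lattice 0.
Proof. by rewrite /lattice /= rpred0. Qed.

Lemma latticeD z w : lattice z -> lattice w -> lattice (z + w).
Proof. by move=> /andP[? ?] /andP[? ?]; rewrite /lattice /= !rpredD. Qed.

Lemma latticeN z : lattice z -> lattice (- z).
Proof. by rewrite /lattice /= !rpredN. Qed.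

Lemma latticeMn z n : lattice z -> lattice (z *+ n).
Proof.
by move=> zL; elim: n => [|n IH]; rewrite ?mulrS ?latticeD// mulr0n lattice0.
Qed.

Lemma torus_projP z w : torus_proj z = torus_proj w <-> lattice (z - w).
Proof. by split=> [/eqquotP|zw]; last apply/eqquotP. Qed.

Lemma torus_projD z g : lattice g -> torus_proj (z + g) = torus_proj z.
Proof. by move=> gL; apply/torus_projP; rewrite addrC addKr. Qed.

Lemma torus_proj_surj x : exists z, torus_proj z = x.
Proof. by exists (repr x); exact: reprK. Qed.

(** The projection is open: the lattice translates of a ball form a saturated open
set. *)
Lemma nbhs_torus z (A : set (torus R)) (e : R) : 0 < e ->
  (forall w, `|z - w| < e -> A (torus_proj w)) -> nbhs (torus_proj z) A.
Proof.
move=> e0 eA.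
pose O := \bigcup_(g in [set g | lattice g]) ball (z + g) e.
have OE : @torus_proj R @^-1` (@torus_proj R @` O) = O.
  apply/seteqP; split=> [w [w' [g gL zw'] /torus_projP ww']|w Ow];
    last by exists w.
  exists (g + (w - w')); first by apply: latticeD; rewrite // -opprB latticeN.
  move: zw'; rewrite -!ball_normE /ball_/=.
  suff -> : z + (g + (w - w')) - w = z + g - w' by [].
  by rewrite !addrA addrAC addrK.
have oO : open (@torus_proj R @` O).
  change (open (@torus_proj R @^-1` (@torus_proj R @` O))); rewrite OE.
  by apply: bigcup_open => g _; exact: ball_open.
apply: (@filterS _ _ _ (@torus_proj R @` O)); last first.
  apply: open_nbhs_nbhs; split=> //; exists z => //; exists 0.
    exact: lattice0.
  by rewrite addr0; exact: ballxx.
move=> _ [w [g gL zw] <-]; rewrite -(torus_projD w (- g)) ?latticeN//.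
by apply: eA; move: zw; rewrite -ball_normE /ball_/= opprB addrA addrAC.
Qed.

Lemma torus_proj_continuous : continuous (@torus_proj R).
Proof. exact: pi_continuous. Qed.

(** Compactness of L, phrased upstairs: a lattice-invariant property of the points
above L that holds locally for large parameters holds for one parameter. *)
Lemma torus_compact_uniform (L : set (torus R)) (Q : R -> plane R -> Prop) :
  compact L ->
  (forall r z g, lattice g -> Q r z -> Q r (z + g)) ->
  (forall z, L (torus_proj z) -> exists r e, 0 < e /\
     forall s w, r <= s -> L (torus_proj w) -> `|z - w| < e -> Q s w) ->
  exists2 r, 0 < r & forall z, L (torus_proj z) -> Q r z.
Proof.
move=> /compact_near_coveringP/near_covering_withinP Lc Qper Qloc.
pose P r x := forall z, torus_proj z = x -> Q r z.
have : \forall r \near +oo, L `<=` P r.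
  apply: Lc => x Lx; have [z zx] := torus_proj_surj x.
  rewrite -zx in Lx *; have [r [e [e0 re]]] := Qloc z Lx.
  exists ([set y | L y -> forall s, r <= s -> P s y], [set s | r <= s]).
    split; last exact: nbhs_pinfty_ge (num_real r).
    apply: (nbhs_torus _ _ _ e0) => w zw Lw s rs w' /torus_projP ww'.
    by rewrite -[w'](subrK w) addrC; apply: Qper => //; exact: re.
  by move=> [y s] /= [yP rs] Ly; exact: yP.
move=> LP; near +oo_R => r; exists r => // z Lz.
have : L `<=` P r by near: r.
by move=> /(_ _ Lz); exact.
Unshelve. all: by end_near. Qed.

(** A Lebesgue number lemma: the balls of the cover get half of the radius given
by the local hypothesis, so that w lies in the full ball as well. *)
Lemma torus_lebesgue_number (L : set (torus R)) (P : plane R -> plane R -> Prop) :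
  compact L ->
  (forall z w g, lattice g -> P z w -> P (z + g) (w + g)) ->
  (forall z, L (torus_proj z) -> exists2 e : R, 0 < e &
     forall w t, `|z - w| < e -> `|z - t| < e -> P w t) ->
  exists2 e : R, 0 < e &
    forall z w, L (torus_proj z) -> `|z - w| < e -> P z w.
Proof.
move=> Lc Pper Ploc.
have [|||r r0 rP] := torus_compact_uniform L
    (fun r z => forall w, `|z - w| < r^-1 -> P z w) => //.
- move=> r z g gL H w zw; rewrite -[w](subrK g); apply: Pper => //.
  by apply: H; move: zw; rewrite opprB addrA.
- move=> z /Ploc[e e0 eP].
  exists (2 / e), (e / 2); split; first by rewrite divr_gt0.
  move=> s w rs _ zw t wt.
  have s0 : 0 < s by apply: lt_le_trans rs; rewrite divr_gt0.
  have wt' : `|w - t| < e / 2.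
    apply: lt_le_trans wt _; rewrite -[leRHS]invrK.
    by rewrite lef_pV2 ?invf_div ?posrE ?divr_gt0.
  apply: eP; first by lra.
  by apply: le_lt_trans (ler_distD w _ _) _; lra.
by exists r^-1; [rewrite invr_gt0|move=> z w Lz; exact: rP].
Qed.

Lemma integer_valued_constant (d : plane R -> R) : continuous d ->
  (forall z, d z \is a Num.int) -> forall z w, d z = d w.
Proof.
move=> dc dZ z w; wlog zw : z w / d z < d w.
  by move=> H; have [/H|/H|] := ltgtP (d z) (d w).
have wz1 : d z + 1 <= d w.
  have := norm_intr_ge1 (rpredB (dZ w) (dZ z)).
  by rewrite subr_eq0 gt_eqF// gtr0_norm ?subr_gt0//; lra.
have [|y yE] := plane_ivt _ d z w (d z + 2^-1) dc; first lra.
have := norm_intr_ge1 (rpredB (dZ y) (dZ z)).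
have -> : d y - d z = 2^-1 by lra.
by rewrite invr_eq0 pnatr_eq0 ger0_norm// => /(_ isT); lra.
Qed.

(** F (z + g) - F z is continuous with lattice values, hence a constant c g, and c
is additive. Uniform rotation, applied at 0 and at g *+ k for every k, bounds all
multiples of c^n g - g once n is large, so c^n = id and c^n.+1 = id on the
lattice, that is c = id. *)
Lemma lift_translation (f : torus R -> torus R) (F : plane R -> plane R) v :
  is_lift f F -> rotation_set F = [set v] ->
  forall z g, lattice g -> F (z + g) = F z + g.
Proof.
move=> [Fc Ff] rotF.
pose c g : plane R := F g - F 0.
have dL z g : lattice g -> lattice (F (z + g) - F z).
  by move=> gL; apply/torus_projP; rewrite !Ff torus_projD.
have cL g : lattice g -> lattice (c g).
  by move=> gL; have := dL 0 g gL; rewrite add0r.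
have Fd g : continuous (fun z => F (z + g) - F z).
  move=> z; apply: cvgB; last exact: Fc.
  apply: (@continuous_comp _ _ _ (fun z => z + g) F); last exact: Fc.
  by apply: cvgD; [exact: cvg_id|exact: cvg_cst].
have cE z g : lattice g -> F (z + g) = F z + c g.
  move=> gL; apply/eqP; rewrite [F z + _]addrC -subr_eq /c -{2}[g]add0r; apply/eqP.
  apply: injective_projections.
    apply: (integer_valued_constant (fun z => (F (z + g) - F z).1)) => [w|w].
      by apply: (cvg_comp _ fst (Fd g w)); exact: cvg_fst.
    by have /andP[] := dL w g gL.
  apply: (integer_valued_constant (fun z => (F (z + g) - F z).2)) => [w|w].
    by apply: (cvg_comp _ snd (Fd g w)); exact: cvg_snd.
  by have /andP[] := dL w g gL.
have cMn g k : lattice g -> c (g *+ k) = c g *+ k.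
  move=> gL; elim: k => [|k IH]; first by rewrite !mulr0n /c subrr.
  by rewrite !mulrSr -IH {1}/c cE// addrAC.
have itcL n g : lattice g -> lattice (iter n c g).
  by move=> gL; elim: n => //= n IH; exact: cL.
have itcMn n g k : lattice g -> iter n c (g *+ k) = iter n c g *+ k.
  by move=> gL; elim: n => //= n ->; rewrite cMn ?itcL.
have itF n z g : lattice g -> iter n F (z + g) = iter n F z + iter n c g.
  by move=> gL; elim: n => //= n ->; rewrite cE ?itcL.
have [N NP] := uniform_rotation _ F v 1 Fc rotF ltr01.
have itc n g : (N <= n)%N -> lattice g -> iter n c g = g.
  move=> Nn gL; apply/eqP; rewrite -subr_eq0 -normr_eq0; apply/negPn/negP => D0.
  have Dk k : k%:R * `|iter n c g - g| <= n%:R + n%:R.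
    rewrite mulr_natl -normrMn mulrnBl -itcMn//.
    have -> : iter n c (g *+ k) - g *+ k =
      (iter n F (0 + g *+ k) - (0 + g *+ k) - n%:R *: v) -
      (iter n F 0 - 0 - n%:R *: v).
      rewrite itF ?latticeMn// add0r subr0 opprB addrA subrK.
      by rewrite addrAC [iter n F 0 + _]addrC addrK.
    apply: le_trans (ler_normB _ _) _.
    by apply: lerD; rewrite -[leRHS]mulr1; exact: NP.
  have D1 : 0 < `|iter n c g - g| by rewrite lt_neqAle eq_sym D0 /=.
  have := Dk (Num.truncn ((n%:R + n%:R) / `|iter n c g - g|)).+1.
  apply/negP; rewrite -ltNge -ltr_pdivrMr//.
  exact: truncnS_gt.
move=> z g gL; rewrite cE//; congr (_ + _).
by rewrite -[in LHS](itc N g)// -iterS itc.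
Qed.

End Torus.

(** * Crossing of discrete chains *)

(** A chain b from bottom to top and a chain c from left to right, with short
steps, come close to each other. The signed number of steps of b which cross the
horizontal half-line issued to the right of c j is 1 for j = 0 and 0 for j = k.
It does not depend on j: moving from c j to c j.+1 changes the contribution of
each step of b by a difference of the values of psi at its two ends ([square]),
and these telescope to 0. The identity on a square holds since the four
differences b - c lie in one small cluster away from the origin, which therefore
misses one of the two coordinate axes. *)
Lemma crossing_chains (R : realFieldType) (bx by' cx cy : nat -> R) (m k : nat)
    (rho : R) :
  (forall i, (i < m)%N ->
     `|bx i - bx i.+1| < rho / 2 /\ `|by' i - by' i.+1| < rho / 2) ->
  (forall j, (j < k)%N ->
     `|cx j - cx j.+1| < rho / 2 /\ `|cy j - cy j.+1| < rho / 2) ->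
  (forall i j, (i <= m)%N -> (j <= k)%N ->
     rho <= `|bx i - cx j| \/ rho <= `|by' i - cy j|) ->
  (forall j, (j <= k)%N -> by' 0%N < cy j <= by' m) ->
  (forall i, (i <= m)%N -> cx 0%N < bx i <= cx k) -> False.
Proof.
move=> bstep cstep far bot_top left_right.
pose above (i j : nat) : R := (cy j <= by' i)%R%:R.
pose right (i j : nat) : R := (cx j < bx i)%R%:R.
pose phi i j := (above i.+1 j - above i j) * right i j.
pose psi i j := (above i j.+1 - above i j) * right i j.
have square i j : (i < m)%N -> (j < k)%N ->
    phi i j - phi i j.+1 = - (psi i.+1 j - psi i j).
  move=> im jk; have [bxi byi] := bstep i im; have [cxj cyj] := cstep j jk.
  have farij := far i j (ltnW im) (ltnW jk).
  move: bxi byi cxj cyj; rewrite !ltr_norml => bxi byi cxj cyj.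
  have [yij|yij|xij|xij] : [\/ rho <= by' i - cy j, by' i - cy j <= - rho,
      rho <= bx i - cx j | bx i - cx j <= - rho].
    by case: farij; rewrite ler_normr => /orP[] ?;
      [constructor 3|constructor 4; lra|constructor 1|constructor 2; lra].
  - have [a1 a2 a3 a4] : [/\ above i j = 1, above i.+1 j = 1,
        above i j.+1 = 1 & above i.+1 j.+1 = 1].
      rewrite /above; do 2![rewrite (_ : _ <= _ = true); last lra].
      by do 2![rewrite (_ : _ <= _ = true); last lra].
    by rewrite /phi /psi a1 a2 a3 a4; ring.
  - have [a1 a2 a3 a4] : [/\ above i j = 0, above i.+1 j = 0,
        above i j.+1 = 0 & above i.+1 j.+1 = 0].
      by rewrite /above; split; rewrite leNgt (_ : _ < _ = true)//; lra.
    by rewrite /phi /psi a1 a2 a3 a4; ring.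
  - have [r1 r2 r3] : [/\ right i j = 1, right i.+1 j = 1 & right i j.+1 = 1].
      by rewrite /right; split; rewrite (_ : _ < _ = true)//; lra.
    by rewrite /phi /psi r1 r2 r3; ring.
  - have [r1 r2 r3] : [/\ right i j = 0, right i.+1 j = 0 & right i j.+1 = 0].
      by rewrite /right; split; rewrite ltNge (_ : _ <= _ = true)//; lra.
    by rewrite /phi /psi r1 r2 r3; ring.
have phi_const j : (j <= k)%N -> \sum_(i < m) phi i j = \sum_(i < m) phi i 0%N.
  elim: j => // j IH jk; rewrite -(IH (ltnW jk)).
  apply/eqP; rewrite eq_sym -subr_eq0 -sumrB.
  rewrite (eq_bigr (fun i : 'I_m => - (psi i.+1 j - psi i j))); last first.
    by move=> i _; exact: square.
  rewrite sumrN -(big_mkord xpredT (fun i => psi i.+1 j - psi i j)).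
  rewrite telescope_sumr// /psi /above.
  have /andP[b0 bm] := bot_top j (ltnW jk).
  have /andP[b0' bm'] := bot_top j.+1 jk.
  by rewrite bm bm' !leNgt b0 b0'/= !subrr !mul0r subrr oppr0.
have : \sum_(i < m) phi i k = 0.
  apply: big1 => i _; have /andP[_ ik] := left_right i (ltnW (ltn_ord i)).
  by rewrite /phi /right ltNge ik mulr0.
rewrite phi_const// => /eqP; apply/negP.
have /andP[b0 bm] := bot_top 0%N (leq0n k).
rewrite (eq_bigr (fun i : 'I_m => above i.+1 0%N - above i 0%N)); last first.
  move=> i _; have /andP[i0 _] := left_right i (ltnW (ltn_ord i)).
  by rewrite /phi /right i0 mulr1.
rewrite -(big_mkord xpredT (fun i => above i.+1 0%N - above i 0%N)).
by rewrite telescope_sumr// /above bm leNgt b0 subr0 oner_eq0.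
Qed.

Section Chains.
Variable R : realType.
Implicit Types (S : set (plane R)) (e : R) (z w g h : plane R).

Definition link S e z w := [/\ S z, S w & `|z - w| < e].
Definition chain S e := clos_refl_trans _ (link S e).

Lemma chain_map S S' e e' (t : plane R -> plane R) :
  (forall z w, link S e z w -> link S' e' (t z) (t w)) ->
  forall z w, chain S e z w -> chain S' e' (t z) (t w).
Proof.
move=> tl z w; elim=> [z1 w1 /tl|z1|z1 w1 u1 _ zw _ wu].
- exact: rt_step.
- exact: rt_refl.
- exact: rt_trans zw wu.
Qed.

Lemma chain_sub S S' e e' : S `<=` S' -> e <= e' ->
  forall z w, chain S e z w -> chain S' e' z w.
Proof.
move=> SS ee; apply: (chain_map _ _ _ _ id) => z w [Sz Sw zw].
by split; [exact: SS|exact: SS|exact: lt_le_trans ee].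
Qed.

Lemma chain_sym S e z w : chain S e z w -> chain S e w z.
Proof.
elim=> [z1 w1 [? ? ?]|z1|z1 w1 u1 _ zw _ wu].
- by apply: rt_step; split=> //; rewrite distrC.
- exact: rt_refl.
- exact: rt_trans wu zw.
Qed.

(** Chains are handled as closures, which concatenate freely; the crossing count
needs them as indexed sequences. *)
Lemma chain_sequence S e z w : chain S e z w -> S z ->
  exists n (b : nat -> plane R), [/\ b 0%N = z, b n = w,
    forall i, (i <= n)%N -> S (b i) &
    forall i, (i < n)%N -> `|b i - b i.+1| < e].
Proof.
move=> zw; elim: {w zw}(clos_rt_rtn1 _ _ _ _ zw) => [Sz|w1 w2 [S1 S2 w12] _ IH Sz].
  by exists 0%N, (fun=> z); split.
have [n [b [b0 bn bS be]]] := IH Sz.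
exists n.+1, (fun i => if (i <= n)%N then b i else w2); split => //.
- by rewrite ltnn.
- by move=> i _; case: ifP => // /bS.
- move=> i; rewrite ltnS leq_eqVlt => /orP[/eqP ->|ni].
    by rewrite eqxx ltnn bn.
  by rewrite ni orbT; exact: be.
Qed.

(** A chain is finite, so any function is bounded along it. Keeping the bound in
the carrier of the chain lets it survive concatenation of translates. *)
Lemma chain_bounded S e (X : plane R -> R) z w : chain S e z w ->
  exists B, forall B', B <= B' -> chain (S `&` [set u | `|X u| <= B']) e z w.
Proof.
elim=> [z1 w1 [Sz Sw zw]|z1|z1 w1 u1 _ [B1 H1] _ [B2 H2]].
- exists (`|X z1| + `|X w1|) => B' BB'; apply: rt_step; split=> //; split=> //=.
    by apply: le_trans BB'; rewrite lerDl.
  by apply: le_trans BB'; rewrite lerDr.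
- by exists 0 => ? _; exact: rt_refl.
- exists (Num.max B1 B2) => B'; rewrite ge_max => /andP[? ?].
  by apply: rt_trans; [exact: H1|exact: H2].
Qed.

Lemma connected_chain (C : set (plane R)) e z w : 0 < e ->
  connected C -> C z -> C w -> chain C e z w.
Proof.
move=> e0 Cc Cz Cw.
have := connected_linked _ C (fun u v => `|u - v| < e) _ _ Cc z w Cz Cw.
apply; first by move=> u v; rewrite distrC.
by move=> u _; have := nbhsx_ballx u e e0; rewrite -ball_normE.
Qed.

End Chains.

(** * Periodic chains as barriers *)

Section Planar.
Variable R : realType.
Implicit Types (S C : set (plane R)) (z w u g h : plane R).

Definition dot z w : R := z.1 * w.1 + z.2 * w.2.
Definition det z w : R := z.1 * w.2 - z.2 * w.1.

Lemma dotD z w u : dot (z + w) u = dot z u + dot w u.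
Proof. by rewrite /dot /=; ring. Qed.

Lemma dotN z u : dot (- z) u = - dot z u.
Proof. by rewrite /dot /=; ring. Qed.

Lemma dotZ (k : R) z u : dot (k *: z) u = k * dot z u.
Proof. by rewrite /dot /= /GRing.scale /=; ring. Qed.

Lemma detD z w u : det (z + w) u = det z u + det w u.
Proof. by rewrite /det /=; ring. Qed.

Lemma detN z u : det (- z) u = - det z u.
Proof. by rewrite /det /=; ring. Qed.

Lemma detZ (k : R) z u : det (k *: z) u = k * det z u.
Proof. by rewrite /det /= /GRing.scale /=; ring. Qed.

Lemma dot_le z u : `|dot z u| <= 2 * `|u| * `|z|.
Proof.
have /andP[z1 z2] : (`|z.1| <= `|z|) && (`|z.2| <= `|z|).
  by rewrite -plane_norm_le.
have /andP[u1 u2] : (`|u.1| <= `|u|) && (`|u.2| <= `|u|).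
  by rewrite -plane_norm_le.
apply: le_trans (ler_normD _ _) _; rewrite !normrM.
have -> : 2 * `|u| * `|z| = `|z| * `|u| + `|z| * `|u| by ring.
by apply: lerD; apply: ler_pM.
Qed.

Lemma det_dot z u : det z u = dot z (u.2, - u.1).
Proof. by rewrite /det /dot /=; ring. Qed.

Lemma det_le z u : `|det z u| <= 2 * `|u| * `|z|.
Proof.
rewrite det_dot; apply: le_trans (dot_le _ _) _.
suff -> : `|((u.2, - u.1) : plane R)| = `|u| by [].
by rewrite !prod_normE/= normrN maxC.
Qed.

Lemma norm_sqr_le u : `|u| ^+ 2 <= dot u u.
Proof.
rewrite prod_normE /dot; case: (leP `|u.1| `|u.2|) => _;
  rewrite real_normK ?num_real//.
  by rewrite expr2 lerDr sqr_ge0.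
by rewrite expr2 lerDl sqr_ge0.
Qed.

(** (det z u, dot z u) are, up to the Euclidean length of u, the coordinates of z
in an orthogonal frame with second axis along u; one of them is at least the
length of z over sqrt 2. *)
Lemma dot_det_ge z u (e : R) : 0 <= e -> e <= `|z| ->
  `|u| * e / 2 <= `|det z u| \/ `|u| * e / 2 <= `|dot z u|.
Proof.
move=> e0 ez; apply/orP; rewrite -[_ || _]negbK negb_or -!ltNge.
apply/negP => /andP[H1 H2].
have r0 : 0 <= `|u| * e / 2 by rewrite divr_ge0// mulr_ge0.
have sq (a : R) : `|a| < `|u| * e / 2 -> a ^+ 2 <= (`|u| * e / 2) ^+ 2.
  by move=> /ltW ha; rewrite -[a ^+ 2]real_normK ?num_real// lerXn2r// nnegrE.
have id2 : det z u ^+ 2 + dot z u ^+ 2 = dot u u * dot z z.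
  by rewrite /det /dot; ring.
have p0 : 0 < `|u| * e / 2 by apply: le_lt_trans H1.
have lo : (`|u| * e) ^+ 2 <= dot u u * dot z z.
  rewrite exprMn; apply: ler_pM; rewrite ?sqr_ge0// ?norm_sqr_le//.
  by apply: le_trans (norm_sqr_le _); rewrite lerXn2r// nnegrE.
have := sq _ H1; have := sq _ H2; rewrite -id2 in lo; nra.
Qed.

(** In the coordinates det _ h and dot _ h, the chain from z to z + h repeats into
arbitrarily high vertical chains of bounded width. A set C that is wide enough
has one of their lattice translates between two of its points, and a chain
inside C joining these points would have to cross it. *)
Lemma chain_barrier S (e : R) z h : 0 < e -> h != 0 ->
  (forall g, lattice R g -> forall w, S w -> S (w + g)) ->
  lattice R h -> S z -> chain R S (e / 8) z (z + h) ->
  exists K, forall C, connected C ->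
    (forall s c, S s -> C c -> e <= `|s - c|) ->
    forall w w', C w -> C w' -> det (w' - w) h <= K.
Proof.
move=> e0 h0 Sper hL Sz zh.
have q0 : 0 < dot h h.
  by apply: lt_le_trans (norm_sqr_le _); rewrite exprn_gt0// normr_gt0.
have [B [zB zhB]] : exists B, `|det z h| <= B /\
    chain R (S `&` [set u | `|det u h| <= B]) (e / 8) z (z + h).
  have [B BP] := chain_bounded R S (e / 8) (fun u => det u h) _ _ zh.
  exists (Num.max B `|det z h|); rewrite le_max lexx orbT; split=> //.
  by apply: BP; rewrite le_max lexx.
pose SB := S `&` [set u | `|det u h| <= B].
have SBper t : lattice R t -> forall u v, chain R SB (e / 8) u v ->
    chain R (S `&` [set u | `|det (u - t) h| <= B]) (e / 8) (u + t) (v + t).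
  move=> tL; apply: chain_map => u v [[Su uB] [Sv vB] uv].
  split; [split|split|] => /=; rewrite ?addrK//; try exact: Sper.
  by rewrite opprD addrACA subrr addr0.
have hh0 : det h h = 0 by rewrite /det; ring.
have detMn n : det (h *+ n) h = 0.
  by rewrite -scaler_nat detZ hh0 mulr0.
have SBper0 t : lattice R t -> det t h = 0 -> forall u v,
    chain R SB (e / 8) u v -> chain R SB (e / 8) (u + t) (v + t).
  move=> tL t0 u v /(SBper t tL); apply: chain_sub => // x [Sx xB]; split=> //.
  by move: xB => /=; rewrite detD detN t0 subr0.
have long M : chain R SB (e / 8) (z - h *+ M) (z + h *+ M).
  elim: M => [|M IH]; first by rewrite mulr0n subr0 addr0; exact: rt_refl.
  apply: (rt_trans _ _ _ (z - h *+ M)).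
    have -> : z - h *+ M = z + h - h *+ M.+1 by rewrite mulrS opprD addrA addrK.
    apply: (SBper0 _ _ _ _ _ zhB); first by rewrite latticeN// latticeMn.
    by rewrite detN detMn oppr0.
  have -> : z + h *+ M.+1 = z + h + h *+ M by rewrite mulrS addrA.
  by apply: rt_trans IH (SBper0 _ _ _ _ _ zhB); [exact: latticeMn|exact: detMn].
exists (2 * B + dot h h) => C Cc far w w' Cw Cw'; rewrite leNgt; apply/negP => wide.
(* (h.2, - h.1) is the horizontal direction; its multiple g puts the barrier
   strictly between w and w'. *)
pose k := Num.floor ((det w h + B) / dot h h) + 1.
pose g : plane R := k%:~R *: ((h.2, - h.1) : plane R).
have gL : lattice R g.
  by case/andP: hL => h1 h2; rewrite /lattice /g /= !rpredM ?rpredN ?intr_int.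
have gE : det g h = k%:~R * dot h h by rewrite /g detZ /det /dot /=; ring.
have /andP[kg kl] : det w h + B < det g h <= det w h + B + dot h h.
  have /andP[fl fr] := floor_itv ((det w h + B) / dot h h).
  rewrite gE -ltr_pdivrMr// fr /=.
  move: fl; rewrite ler_pdivlMr// => fl; rewrite /k intrD mulrDl mul1r.
  by rewrite lerD2r.
have [n [c [c0 cn cC cs]]] := chain_sequence _ _ _ _ _
  (connected_chain _ C (e / 8) w w' ltac:(lra) Cc Cw Cw') Cw.
pose D := \sum_(j < n.+1) `|dot (c j) h|.
have cD j : (j <= n)%N -> `|dot (c j) h| <= D.
  move=> jn; rewrite /D (bigD1 (Ordinal (jn : (j < n.+1)%N)))//= lerDl.
  by apply: sumr_ge0 => *; exact: normr_ge0.
(* M repetitions of h overtop the chain c on both sides. *)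
pose M := (Num.truncn ((D + `|dot (z + g) h|) / dot h h)).+1.
have DM : D + `|dot (z + g) h| < M%:R * dot h h.
  by rewrite -ltr_pdivrMr// truncnS_gt.
have startS : (S `&` [set u | `|det (u - g) h| <= B]) (z - h *+ M + g).
  split=> /=; last by rewrite addrK detD detN detMn subr0.
  by do 2!apply: (Sper) => //; rewrite latticeN// latticeMn.
have [m [b [b0 bm bS bs]]] := chain_sequence _ _ _ _ _
  (SBper g gL _ _ (long M)) startS.
(* dot_det_ge separates the chains by rho, and 2 * |h| * (e / 8) = rho / 2 is
   the room left for the steps: this is the origin of the step e / 8. *)
pose rho := `|h| * e / 2.
have small (u : plane R) : `|u| < e / 8 ->
    `|det u h| < rho / 2 /\ `|dot u h| < rho / 2.
  move=> ue; have hue : `|h| * `|u| < `|h| * (e / 8).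
    by rewrite ltr_pM2l// normr_gt0.
  have := det_le u h; have := dot_le u h; rewrite /rho -!mulrA; lra.
apply: (@crossing_chains R (fun i => det (b i) h) (fun i => dot (b i) h)
  (fun j => det (c j) h) (fun j => dot (c j) h) m n rho).
- by move=> i im; rewrite -detN -detD -dotN -dotD; apply: small; exact: bs.
- by move=> i im; rewrite -detN -detD -dotN -dotD; apply: small; exact: cs.
- move=> i j im jn; rewrite -detN -detD -dotN -dotD.
  apply: dot_det_ge; first exact: ltW.
  by apply: far; [case: (bS i im)|exact: cC].
- move=> j /cD; rewrite b0 bm !dotD dotN -scaler_nat dotZ ler_norml.
  have := ler_norm (dot (z + g) h); have := lerNnormlW (lexx `|dot (z + g) h|).
  rewrite dotD in DM *; lra.
- move=> i /bS[_ /=]; rewrite c0 cn detD detN ler_norml.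
  move: wide; rewrite detD detN; lra.
Qed.
End Planar.

(** * Independence of the chain periods *)

Section Invariant.
Variables (R : realType) (L : set (torus R)).
Local Notation S := (@torus_proj R @^-1` L).
Implicit Types (z w g a : plane R) (e : R).

Lemma preimage_periodic g : lattice R g -> forall z, S z -> S (z + g).
Proof. by move=> gL z; rewrite /= torus_projD. Qed.

Lemma chain_translate e g : lattice R g -> forall z w,
  chain R S e z w -> chain R S e (z + g) (w + g).
Proof.
move=> gL; apply: chain_map => z w [Sz Sw zw].
split; try exact: preimage_periodic.
by rewrite opprD addrACA subrr addr0.
Qed.

(** Chains in the torus lift step by step, from any given starting point. *)
Lemma connected_chain_lattice e z0 z : 0 < e -> connected L ->
  S z0 -> S z -> exists2 g, lattice R g & chain R S e z (z0 + g).
Proof.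
move=> e0 Lc Sz0 Sz.
pose r (x y : torus R) := exists u v,
  [/\ torus_proj u = x, torus_proj v = y & `|u - v| < e].
have rsym x y : r x y -> r y x.
  by move=> [u [v [ux vy uv]]]; exists v, u; split; rewrite // distrC.
have rnear x : L x -> \forall y \near x, r x y.
  move=> _; have [u <-] := torus_proj_surj _ x.
  by apply: (nbhs_torus _ _ _ _ e0) => w uw; exists u, w.
have := connected_linked _ L r rsym rnear Lc _ _ Sz Sz0.
set x := torus_proj z; set y := torus_proj z0.
suff H : forall x y, clos_refl_trans (torus R)
    (fun x y => [/\ L x, L y & r x y]) x y ->
    forall z, torus_proj z = x ->
    exists2 w, torus_proj w = y & chain R S e z w.
  move=> /H /(_ z erefl) [w wy zw]; exists (w - z0); first exact/torus_projP.
  by rewrite addrC subrK.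
move=> {z0 z Sz0 Sz x y} x y.
elim=> [x1 y1 [Lx Ly [u [v [ux vy uv]]]] z zx|x1 z zx|x1 y1 y2 _ H1 _ H2 z zx].
- have uzL : lattice R (z - u) by apply/torus_projP; rewrite zx ux.
  exists (v + (z - u)); first by rewrite torus_projD.
  apply: rt_step; split => /=; rewrite ?torus_projD ?zx ?vy//.
  suff -> : z - (v + (z - u)) = u - v by [].
  by rewrite opprD opprB addrCA [z + _]addrC subrK addrC.
- by exists z => //; exact: rt_refl.
- have [w wy zw] := H1 z zx; have [t ty wt] := H2 w wy.
  by exists t => //; apply: rt_trans zw wt.
Qed.

(** A lattice vector a killing the chain periods of S yields an integer c with
dot a v = c, so a = 0 by rational independence. *)
Lemma annihilator_trivial (f : torus R -> torus R) F v e z0 a :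
  is_lift f F -> rotation_set F = [set v] -> rationally_independent1 v ->
  compact L -> connected L -> f @` L `<=` L ->
  0 < e -> S z0 -> lattice R a ->
  (forall g, lattice R g -> chain R S e z0 (z0 + g) -> dot R a g = 0) ->
  a = 0.
Proof.
move=> Ff rotF vind Lcpt Lc fL e0 Sz0 aL ann.
have Ftr := lift_translation R f F v Ff rotF.
have SF z : S z -> S (F z).
  by move=> Sz; rewrite /= Ff.2; apply: fL; exists (torus_proj z).
(* F maps d-chains to e-chains. *)
have [d [d0 de dF]] : exists d, [/\ 0 < d, d <= e &
    forall z w, S z -> `|z - w| < d -> `|F z - F w| < e].
  have [|z Sz|d d0 dF] := torus_lebesgue_number R L
      (fun z w => `|F z - F w| < e) Lcpt.
  - by move=> z w g gL; rewrite !Ftr// opprD addrACA subrr addr0.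
  - have /cvgrPdist_lt/(_ (e / 2)) := Ff.1 z.
    rewrite divr_gt0// => /(_ isT) /nbhs_ballP[d /= d0 dF].
    exists d => // w t zw zt.
    have Fw : `|F z - F w| < e / 2 by apply: dF; rewrite -ball_normE.
    have Ft : `|F z - F t| < e / 2 by apply: dF; rewrite -ball_normE.
    apply: le_lt_trans (ler_distD (F z) _ _) _.
    by rewrite [`|F w - _|]distrC; lra.
  exists (Num.min d e); split.
  - by rewrite lt_min d0.
  - by rewrite ge_min lexx orbT.
  - by move=> z w Sz; rewrite lt_min => /andP[zw _]; exact: dF.
(* The integer shadow of dot a, as a relation; it is single valued because a
   kills the periods. *)
pose lab z (m : R) := exists g, [/\ lattice R g, dot R a g = m &
  chain R S e z (z0 + g)].
have lab_uniq z m m' : lab z m -> lab z m' -> m = m'.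
  move=> [g [gL <- zg]] [g' [g'L <- zg']].
  have g'gL : lattice R (g' - g) by rewrite latticeD ?latticeN.
  have : chain R S e z0 (z0 + (g' - g)).
    have := chain_translate e (- g) (latticeN _ _ gL) _ _
       (rt_trans _ _ _ _ _ (chain_sym _ _ _ _ _ zg) zg').
    by rewrite addrK addrA.
  by move=> /(ann _ g'gL); rewrite /dot /=; lra.
have lab_exists z : S z -> exists m, lab z m.
  move=> Sz; have [g gL zg] := connected_chain_lattice e z0 z e0 Lc Sz0 Sz.
  by exists (dot R a g), g.
have lab_step z w m : lab w m -> chain R S e z w -> lab z m.
  by move=> [g [gL gm wg]] zw; exists g; split=> //; apply: rt_trans zw wg.
have lab_tr z g m : lattice R g -> lab z m -> lab (z + g) (m + dot R a g).
  move=> gL [h [hL <- zh]]; exists (h + g); split; first exact: latticeD.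
    by rewrite /dot /=; ring.
  by rewrite addrA; exact: chain_translate.
have [C C0 CP] : exists2 C, 0 < C & forall z, S z -> forall m, lab z m ->
    `|dot R a z - m| <= C.
  apply: (torus_compact_uniform R L
    (fun C z => forall m, lab z m -> `|dot R a z - m| <= C)) => //.
  - move=> C z g gL H m zgm.
    have := lab_tr _ (- g) _ (latticeN _ _ gL) zgm; rewrite addrK => /H.
    by congr (`|_| <= C); rewrite /dot /=; ring.
  - move=> z Sz; have [m zm] := lab_exists z Sz.
    exists (`|dot R a z - m| + 2 * `|a| * e), e; split=> // s w rs Sw zw m' wm'.
    have -> : m' = m.
      apply: lab_uniq zm; apply: lab_step wm' _.
      exact: rt_step.
    apply: le_trans rs.
    have -> : dot R a w - m = (dot R a z - m) + dot R a (w - z).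
      by rewrite /dot /=; ring.
    apply: le_trans (ler_normD _ _) _; rewrite lerD2l.
    rewrite /dot [a.1 * _]mulrC [a.2 * _]mulrC -/(dot R (w - z) a).
    apply: le_trans (dot_le _ _ _) _; rewrite ler_wpM2l ?mulr_ge0//.
    by rewrite distrC ltW.
have [g0 g0L Fz0] := connected_chain_lattice d z0 (F z0) d0 Lc Sz0 (SF _ Sz0).
pose c := dot R a g0.
(* Any e-label of z is also given by a d-chain, whose image under F is an
   e-chain from F z to F z0 + g. *)
have labF z m : S z -> lab z m -> lab (F z) (m + c).
  move=> Sz zm; have [g gL zg] := connected_chain_lattice d z0 z d0 Lc Sz0 Sz.
  have -> : m = dot R a g.
    apply: lab_uniq zm _; exists g; split=> //.
    exact: (chain_sub _ _ _ _ _ (fun x h => h) de _ _ zg).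
  have dlink u w : link R S d u w -> link R S e (F u) (F w).
    by move=> [Su Sw uw]; split; [exact: SF|exact: SF|exact: dF].
  apply: lab_step (chain_map _ _ _ _ _ F dlink _ _ zg).
  rewrite Ftr// [_ + c]addrC; apply: lab_tr => //.
  exists g0; split=> //; exact: (chain_sub _ _ _ _ _ (fun x h => h) de _ _ Fz0).
have itF n : S (iter n F z0) /\ lab (iter n F z0) (n%:R * c).
  elim: n => [|n [IH1 IH2]] /=; last first.
    split; first exact: SF.
    by rewrite -natr1 mulrDl mul1r; exact: labF.
  split=> //; exists 0; split; first exact: lattice0.
    by rewrite /dot /= !mulr0 addr0 mul0r.
  by rewrite addr0; exact: rt_refl.
have rat_rel : dot R a v - c = 0.
  apply/eqP; rewrite -normr_eq0; apply/negPn/negP => D0.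
  set D := dot R a v - c in D0.
  have D1 : 0 < `|D| by rewrite lt_neqAle eq_sym D0 /=.
  pose r := `|D| / (2 * (2 * `|a| + 1)).
  have a1 : 0 < 2 * `|a| + 1 by rewrite ltr_wpDl// mulr_ge0.
  have r0 : 0 < r by rewrite divr_gt0// mulr_gt0.
  have ar : 2 * `|a| * r <= `|D| / 2.
    have : r * (2 * (2 * `|a| + 1)) = `|D|.
      by rewrite /r divfK// mulf_neq0// gt_eqF.
    move: r0; lra.
  have [N NP] := uniform_rotation R F v r Ff.1 rotF r0.
  pose n := maxn N (Num.truncn (2 * (C + `|dot R a z0|) / `|D|)).+1.
  have nD : C + `|dot R a z0| < n%:R * (`|D| / 2).
    have : 2 * (C + `|dot R a z0|) < n%:R * `|D|.
      rewrite -ltr_pdivrMr//; apply: lt_le_trans (truncnS_gt _) _.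
      by rewrite ler_nat leq_maxr.
    lra.
  have [Sn labn] := itF n.
  have H1 := CP _ Sn _ labn.
  have H2 := NP n (leq_maxl _ _) z0.
  set u := iter n F z0 - z0 - n%:R *: v in H2.
  have H3 : `|dot R u a| <= n%:R * (`|D| / 2).
    apply: le_trans (dot_le _ _ _) _.
    apply: le_trans (_ : 2 * `|a| * (n%:R * r) <= _).
      by rewrite ler_wpM2l ?mulr_ge0.
    by rewrite mulrCA ler_wpM2l.
  have : n%:R * D = (dot R a (iter n F z0) - n%:R * c) - dot R a z0 - dot R u a.
    by rewrite /D /u /dot /= /GRing.scale /=; ring.
  move=> /(congr1 Num.norm); rewrite normrM [ `|n%:R|]ger0_norm//.
  have := ler_normB (dot R a (iter n F z0) - n%:R * c - dot R a z0) (dot R u a).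
  have := ler_normB (dot R a (iter n F z0) - n%:R * c) (dot R a z0).
  lra.
have cZ : c \is a Num.int.
  by case/andP: g0L => ? ?; case/andP: aL => ? ?; rewrite /c /dot rpredD ?rpredM.
case/andP: aL => /intrP[a1 a1E] /intrP[a2 a2E]; have /intrP[k kE] := cZ.
have [] := vind (- k%:~R) a1%:~R a2%:~R.
  rewrite rmorphN /= !ratr_int -a1E -a2E -kE -[RHS]rat_rel /dot; ring.
move=> _ /eqP; rewrite intr_eq0 => /eqP a10 /eqP; rewrite intr_eq0 => /eqP a20.
by apply: injective_projections; rewrite ?a1E ?a2E ?a10 ?a20.
Qed.
End Invariant.

(** * Boundedness of sets that avoid the neighbourhood *)

Lemma uniform_tube (R : realType) (L U : set (torus R)) :
  compact L -> set_nbhs L U -> exists2 e : R, 0 < e &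
    forall z w : plane R, L (torus_proj z) -> `|z - w| < e -> U (torus_proj w).
Proof.
move=> Lc LU.
apply: (torus_lebesgue_number R L (fun _ w => U (torus_proj w))) => //.
  by move=> z w g gL; rewrite torus_projD.
move=> z Lz.
have /nbhs_ballP[e /= e0 eU] := torus_proj_continuous R z _ (LU _ Lz).
by exists e => // w t _ zt; apply: eU; rewrite -ball_normE.
Qed.

Lemma euclidean_dist_le (R : realType) (z w : plane R) :
  euclidean_dist z w <= `|(z - w).1| + `|(z - w).2|.
Proof.
rewrite /euclidean_dist -[leRHS]ger0_norm ?addr_ge0// -sqrtr_sqr ler_wsqrtr//.
rewrite [leRHS]sqrrD !real_normK ?num_real// lerD2r lerDl mulrn_wge0// mulr_ge0//.
Qed.

(** Cramer's rule: det g h *: u = det u h *: g - det u g *: h, with an integer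
determinant. *)
Lemma det_basis_bound (R : realType) (g h u : plane R) (A B : R) :
  lattice R g -> lattice R h -> det R g h != 0 ->
  `|det R u h| <= A -> `|det R u g| <= B ->
  `|u.1| + `|u.2| <= 2 * (A * `|g| + B * `|h|).
Proof.
move=> /andP[g1 g2] /andP[h1 h2] D0 uA uB.
have D1 : 1 <= `|det R g h|.
  by apply: norm_intr_ge1 D0; rewrite /det rpredB ?rpredM.
have coord (x y z : R) : `|x| <= `|g| -> `|y| <= `|h| ->
    det R g h * z = det R u h * x - det R u g * y ->
    `|z| <= A * `|g| + B * `|h|.
  move=> xg yh E; apply: le_trans (ler_peMl (normr_ge0 z) D1) _.
  rewrite -normrM E; apply: le_trans (ler_normB _ _) _; rewrite !normrM.
  by apply: lerD; apply: ler_pM.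
have /andP[gn1 gn2] : (`|g.1| <= `|g|) && (`|g.2| <= `|g|).
  by rewrite -plane_norm_le.
have /andP[hn1 hn2] : (`|h.1| <= `|h|) && (`|h.2| <= `|h|).
  by rewrite -plane_norm_le.
rewrite mulr2n mulrDl mul1r; apply: lerD.
  by apply: (coord g.1 h.1) => //; rewrite /det; ring.
by apply: (coord g.2 h.2) => //; rewrite /det; ring.
Qed.

Theorem propositionB (R : realType) (f : torus R -> torus R)
  (L1 : set (torus R)) :
  non_resonant f ->
  L1 !=set0 -> compact L1 -> connected L1 -> f @` L1 `<=` L1 ->
  forall U : set (torus R), connected U -> set_nbhs L1 U ->
  exists2 K : R, 0 < K &
    forall L2 : set (torus R), compact L2 ->
      (exists2 z : plane R, (@torus_proj R @^-1` L2) z &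
        (K%:E < diameter (connected_component (@torus_proj R @^-1` L2) z))%E) ->
      U `&` L2 !=set0.
Proof.
move=> [_ [F [v [Ff rotF vind]]]] [x Lx] Lcpt Lc fL U _ LU.
have [e e0 eU] := uniform_tube R L1 U Lcpt LU.
have [z0 z0x] := torus_proj_surj R x; rewrite -z0x in Lx.
pose S := @torus_proj R @^-1` L1.
pose period g := lattice R g /\ chain R S (e / 8) z0 (z0 + g).
have ann a : lattice R a -> (forall g, period g -> dot R a g = 0) -> a = 0.
  move=> aL aP; apply: (annihilator_trivial R L1 f F v (e / 8) z0) => //.
    by rewrite divr_gt0.
  by move=> g gL gz; apply: aP.
have [g [gL gz] g0] : exists2 g, period g & g != 0.
  (* If 0 is the only period, then (1, 0) kills all of them. *)
  apply: contrapT => no; have : ((1, 0) : plane R) = 0.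
    apply: ann; first by rewrite /lattice /= rpred1 rpred0.
    move=> g gP; have -> : g = 0.
      by apply/eqP/negPn/negP => g0; apply: no; exists g.
    by rewrite /dot /= !mulr0 addr0.
  by move=> [] /eqP; rewrite oner_eq0.
have [h [hL hz] gh0] : exists2 h, period h & det R g h != 0.
  (* If all periods are parallel to g, then (- g.2, g.1) kills them. *)
  apply: contrapT => no.
  have [/eqP + /eqP] : ((- g.2, g.1) : plane R) = 0.
    apply: ann.
      by case/andP: gL => g1 g2; rewrite /lattice /= rpredN g1 g2.
    move=> h hP; have <- : det R g h = 0.
      by apply/eqP/negPn/negP => gh; apply: no; exists h.
    by rewrite /dot /det /=; ring.
  rewrite oppr_eq0 => /eqP g2 /eqP g1.
  by move/eqP: g0; apply; apply: injective_projections.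
have h0 : h != 0.
  by apply: contraNneq gh0 => ->; rewrite /det /= !mulr0 subr0.
have Sper := preimage_periodic R L1.
have [A AP] := chain_barrier R S e z0 h e0 h0 Sper hL Lx hz.
have [B BP] := chain_barrier R S e z0 g e0 g0 Sper gL Lx gz.
exists (2 * (`|A| * `|g| + `|B| * `|h|) + 1).
  by rewrite ltr_wpDl// mulr_ge0// addr_ge0// mulr_ge0.
move=> L2 _ [z zL2]; apply: contraPP => UL2.
pose C := connected_component (@torus_proj R @^-1` L2) z.
have far s c : S s -> C c -> e <= `|s - c|.
  move=> Ss Cc; rewrite leNgt; apply/negP => sc; apply: UL2.
  exists (torus_proj c); split; first exact: eU sc.
  exact: (connected_component_sub Cc).
have Cc : connected C by exact: component_connected.
apply/negP; rewrite -leNgt; apply: ge_ereal_sup => _ [[w w'] /= [Cw Cw'] <-].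
rewrite lee_fin; apply: le_trans (euclidean_dist_le _ _ _) _.
apply: le_trans (_ : 2 * (`|A| * `|g| + `|B| * `|h|) <= _); last by rewrite lerDl.
have bound k K : (forall w w', C w -> C w' -> det R (w' - w) k <= K) ->
    `|det R (w - w') k| <= `|K|.
  move=> H; have := H _ _ Cw Cw'; have := H _ _ Cw' Cw.
  rewrite -[w' - w]opprB detN => H1 H2.
  by apply: le_trans (ler_norm K); rewrite ler_norml; lra.
apply: det_basis_bound => //; apply: bound; [exact: AP|exact: BP].
Qed.
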